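(* Let $s>0$ be real and let $p$ be an integer such that $0\le p<s$. Then there exists a constant $c_0>0$, depending only on $s$ and $p$, such that the following holds. For every linear operator $\mathcal{A}:L^2(\mathbb{R})\to L^2(\mathbb{R})$ and every $E,\delta>0$ with $\delta\le E$, there exist functions $f\in H^s(\mathbb{R})$ and $f_\delta\in L^2(\mathbb{R})$ satisfying $\|f\|_{H^s(\mathbb{R})}\le E$ and $\|f-f_\delta\|_{L^2(\mathbb{R})}<\delta$, for which $$\|f^{(p)}-\mathcal{A}f_\delta\|_{L^2(\mathbb{R})}\ge c_0\,E^{p/s}\,\delta^{1-p/s}.$$
   Context: The Fourier transform is normalized as $\widehat g(\xi)=\frac{1}{\sqrt{2\pi}}\int_{-\infty}^{\infty}g(x)e^{-i\xi x}\,dx$ and extended to an isometry of $L^2(\mathbb{R})$. For $s\in\mathbb{R}$, the Sobolev space $H^s(\mathbb{R})$ has norm $\|g\|_{H^s(\mathbb{R})}=\left(\int_{-\infty}^{\infty}(1+\xi^2)^s|\widehat g(\xi)|^2\,d\xi\right)^{1/2}$. For $g\in H^s(\mathbb{R})$ and an integer $0\le p\le s$, $g^{(p)}$ denotes the $p$th (weak) derivative, i.e. the function in $L^2(\mathbb{R})$ whose Fourier transform is $(i\xi)^p\widehat g(\xi)$. *)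

(* Defs.v *)
From HB Require Import structures.
From mathcomp Require Import all_boot all_order all_algebra.
From mathcomp Require Import complex.
From mathcomp Require Import all_classical all_reals all_analysis.

Set Implicit Arguments.
Unset Strict Implicit.
Unset Printing Implicit Defensive.

Import Order.TTheory GRing.Theory Num.Theory.
Import numFieldNormedType.Exports.

Local Open Scope classical_set_scope.
Local Open Scope ring_scope.
Local Open Scope complex_scope.

(* Functions on the real line are complex valued, [f : R -> R[i]].  Elements of
   L^2 are represented by functions; statements about them are either stable
   under, or explicitly made up to, almost everywhere equality. *)

(* L^p membership is tested on real and imaginary parts, since
   max(|Re z|, |Im z|) <= |z| <= |Re z| + |Im z|. *)
Definition in_Lp (R : realType) (q : \bar R) (f : R -> R[i]) : Prop :=
  ((fun x => complex.Re (f x)) \in Lfun (@lebesgue_measure R) q) /\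
  ((fun x => complex.Im (f x)) \in Lfun (@lebesgue_measure R) q).

Definition in_L1 (R : realType) (f : R -> R[i]) : Prop := in_Lp 1%E f.

Definition in_L2 (R : realType) (f : R -> R[i]) : Prop := in_Lp 2%:E f.

Definition ae_equal (R : realType) (f g : R -> R[i]) : Prop :=
  {ae @lebesgue_measure R, forall x, f x = g x}.

(* [ComplexField.Normc.normc] is the modulus with values in R. *)
Definition L2norm (R : realType) (f : R -> R[i]) : \bar R :=
  Lnorm (@lebesgue_measure R) 2%:E
    (fun x => (ComplexField.Normc.normc (f x))%:E).

Definition Cintegral (R : realType) (f : R -> R[i]) : R[i] :=
  (\int[@lebesgue_measure R]_x complex.Re (f x)) +i*
  (\int[@lebesgue_measure R]_x complex.Im (f x)).

(* exp(i t) *)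
Definition expi (R : realType) (t : R) : R[i] := cos t +i* sin t.

(* The Fourier integral; meaningful for [g] in L^1. *)
Definition fourier_integral (R : realType) (g : R -> R[i]) (xi : R) : R[i] :=
  (Num.sqrt (2 * pi))^-1%:C * Cintegral (fun x => g x * expi (- (xi * x))).

(* [F] is the Fourier transform of [f] in the sense of L^2, i.e. the value at
   [f] of the continuous extension to L^2 of the (isometric) Fourier integral
   on the dense subspace L^1 /\ L^2.  By Plancherel's theorem such an [F]
   exists for every [f] in L^2, is unique up to a.e. equality, and does not
   depend on the approximating sequence. *)
Definition is_fourier (R : realType) (f F : R -> R[i]) : Prop :=
  [/\ in_L2 f, in_L2 F &
      exists u : nat -> R -> R[i],
        [/\ forall n, in_L1 (u n) /\ in_L2 (u n),
            L2norm (u n \- f) @[n --> \oo] --> 0%E &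
            L2norm (fourier_integral (u n) \- F) @[n --> \oo] --> 0%E]].

(* [f] belongs to H^s and its H^s norm is the real number [N].  Only used for
   s >= 0, where H^s is a subspace of L^2. *)
Definition is_sobolev_norm (R : realType) (s : R) (f : R -> R[i]) (N : R) :
    Prop :=
  exists2 F, is_fourier f F &
    ((\int[@lebesgue_measure R]_xi
        ((1 + xi ^+ 2) `^ s * ComplexField.Normc.normc (F xi) ^+ 2)%R%:E)
       `^ 2^-1 = N%:E)%E.

(* [g], a function in L^2, is the [p]-th weak derivative of [f]. *)
Definition is_weak_derivative (R : realType) (p : nat) (f g : R -> R[i]) :
    Prop :=
  exists2 F, is_fourier f F &
    is_fourier g (fun xi => (0 +i* xi) ^+ p * F xi).

(* A linear operator L^2 -> L^2, given by its action on representatives; no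
   continuity is required.  The values of [A] outside L^2 are irrelevant. *)
Record L2_linear_operator (R : realType) (A : (R -> R[i]) -> (R -> R[i])) :
    Prop := L2LinearOperator {
  L2op_in_L2 : forall f, in_L2 f -> in_L2 (A f) ;
  L2op_ae : forall f g, in_L2 f -> in_L2 g ->
    ae_equal f g -> ae_equal (A f) (A g) ;
  L2op_linear : forall (a : R[i]) f g, in_L2 f -> in_L2 g ->
    ae_equal (A (fun x => a * f x + g x)) (fun x => a * A f x + A g x)
}.

(* Main.v *)
Require Import Defs.
From HB Require Import structures.
From mathcomp Require Import all_boot all_order all_algebra.
From mathcomp Require Import complex.
From mathcomp Require Import ring lra.
From mathcomp Require Import all_classical all_reals all_analysis.
From mathcomp Require Import measurable_realfun.

Set Implicit Arguments.
Unset Strict Implicit.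
Unset Printing Implicit Defensive.

Import Order.TTheory GRing.Theory Num.Theory.
Import numFieldNormedType.Exports.

(** The operator sees only the noisy datum, and it may be fed the zero function:
    when [f] has L^2 norm below delta, the datum 0 is admissible for [f], and a
    linear operator sends 0 to 0 (almost everywhere).  The error is then the L^2
    norm of the [p]-th derivative of [f], and it remains to find [f] with
    L^2 norm below delta, H^s norm at most E and a derivative of order [p] as
    large as interpolation between L^2 and H^s permits.

    Such an [f] is a dilate of one fixed profile phi.  With
    l = (E / delta)^(1/s), which is at least 1, and
    f x = kappa * delta * sqrt l * phi (l * x), the L^2 norm of f is
    kappa * delta times that of phi, the H^s norm is at most
    kappa * delta * l^s = kappa * E times that of phi
    ([sobolev_integral_dilation]), and the [p]-th derivative has norm
    kappa * delta * l^p = kappa * E^(p/s) * delta^(1-p/s) times that of the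
    [p]-th derivative of phi.  The constant kappa depends on phi only, that is,
    on s and p.

    The profile is phi x = x^m e^{-x} / m! for x >= 0 and 0 for x < 0, with an
    integer m >= s.  It is chosen because its transform is explicit:
    integration by parts gives (2 pi)^(-1/2) (1 + i xi)^(-m-1)
    ([fourier_gamma_wave]), which decays fast enough for H^s.  Writing phi_k for
    the function with exponent k, one has phi_k' = phi_(k-1) - phi_k, so the
    derivatives of phi are iterated differences of the phi_k and their
    transforms follow by algebra ([fourier_gamma_deriv]).  All these functions
    lie in both L^1 and L^2, where the L^2 Fourier transform is the Fourier
    integral ([is_fourier_integral]).  That the [p]-th derivative of phi is not
    zero is also read off its transform ([L2norm_gamma_deriv_neq0]). *)

Local Open Scope classical_set_scope.
Local Open Scope ring_scope.
Local Open Scope complex_scope.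

(** * Dilations and the Lebesgue integral *)

Section Dilation.
Context {R : realType}.
Local Notation mu := (@lebesgue_measure R).

Lemma measurable_dilation (l : R) :
  measurable_fun [set: measurableTypeR R]
    (fun x : R => l * x : measurableTypeR R).
Proof. by apply: measurable_funM. Qed.

(** By uniqueness of the Lebesgue measure: [l] times its image under the
    dilation gives every half-open interval its length. *)
Lemma ge0_integral_dilation (l : R) (f : R -> \bar R) : 0 < l ->
  measurable_fun [set: R] f -> (forall x, 0 <= f x)%E ->
  (\int[mu]_x f (l * x)%R = l^-1%:E * \int[mu]_x f x)%E.
Proof.
move=> l0 mf f0.
pose phi := fun x : measurableTypeR R => l * x : measurableTypeR R.
have mphi : measurable_fun [set: measurableTypeR R] phi :=
  measurable_dilation l.
pose phim : {mfun measurableTypeR R >-> measurableTypeR R} :=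
  HB.pack phi (isMeasurableFun.Build _ _ _ _ phi mphi).
pose k : {nonneg R} := NngNum (ltW l0).
have E A : measurable A -> mu A = mscale k (pushforward mu phim) A.
  move=> mA; apply: lebesgue_measure_unique => //= _ [[a b]] _ <-.
  rewrite /mscale/= /pushforward.
  have -> : phi @^-1` `]a, b] = `]l^-1 * a, l^-1 * b]%classic.
    apply/seteqP; split=> x /=; rewrite !in_itv/= /phi.
      by rewrite -!ler_pdivlMl// !ltr_pdivrMl// => /andP[-> ->].
    by rewrite ler_pdivlMl// ltr_pdivrMl// => /andP[-> ->].
  rewrite !lebesgue_measure_itv/= !lte_fin ltr_pM2l ?invr_gt0//.
  case: ifPn => _; last by rewrite mule0.
  by rewrite -!EFinB -EFinM -mulrBr mulrA mulfV ?mul1r// gt_eqF.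
rewrite [in RHS](eq_measure_integral (mscale k (pushforward mu phim)));
  last by move=> A mA _; exact: E.
rewrite ge0_integral_mscale//= ge0_integral_pushforward//=.
by rewrite preimage_setT muleA -EFinM mulVf ?mul1e ?gt_eqF.
Qed.

Lemma integrable_dilation (l : R) (f : R -> R) : 0 < l ->
  mu.-integrable setT (EFin \o f) ->
  mu.-integrable setT (EFin \o (fun x => f (l * x))).
Proof.
move=> l0 /integrableP[mf fi]; apply/integrableP; split.
  by apply: (measurableT_comp mf); exact: measurable_dilation.
rewrite (ge0_integral_dilation (f := fun x => `|(f x)%:E|%E))//.
  by rewrite lte_mul_pinfty// lee_fin invr_ge0 ltW.
exact: measurableT_comp.
Qed.

Lemma Rintegral_dilation (l : R) (f : R -> R) : 0 < l ->
  mu.-integrable setT (EFin \o f) ->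
  \int[mu]_x f (l * x) = l^-1 * \int[mu]_x f x.
Proof.
move=> l0 fi; have mf := measurable_int _ fi.
rewrite /Rintegral -[l^-1]/(fine l^-1%:E) -fineM//; last first.
  exact: integrable_fin_num.
congr fine.
rewrite [LHS]integralE [in RHS]integralE.
rewrite muleBr//; last first.
  by rewrite fin_num_adde_defr// integrable_pos_fin_num.
congr (_ - _)%E.
- rewrite -ge0_integral_dilation//; last exact: measurable_funepos.
  by apply: eq_integral => x _; rewrite !funeposE.
- rewrite -ge0_integral_dilation//; last exact: measurable_funeneg.
  by apply: eq_integral => x _; rewrite !funenegE.
Qed.

End Dilation.

(** * Complex valued functions: moduli, measurability, L^1 and L^2 *)

Local Notation normc := ComplexField.Normc.normc.
Local Notation Re := complex.Re.
Local Notation Im := complex.Im.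

Section Complex.
Context {R : realType}.
Local Notation mu := (@lebesgue_measure R).
Implicit Types (f g : R -> R[i]) (c z : R[i]).

Lemma Re_mul z c : Re (z * c) = Re z * Re c - Im z * Im c.
Proof. by case: z c => [? ?] [? ?]. Qed.

Lemma Im_mul z c : Im (z * c) = Re z * Im c + Im z * Re c.
Proof. by case: z c => [? ?] [? ?] /=. Qed.

Lemma Re_sub z c : Re (z - c) = Re z - Re c.
Proof. by case: z c => [? ?] [? ?]. Qed.

Lemma Im_sub z c : Im (z - c) = Im z - Im c.
Proof. by case: z c => [? ?] [? ?]. Qed.

Lemma sqr_normcE z : normc z ^+ 2 = Re z ^+ 2 + Im z ^+ 2.
Proof. by case: z => a b; rewrite /= sqr_sqrtr// addr_ge0// sqr_ge0. Qed.

Lemma normc_ge0 z : 0 <= normc z.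
Proof. by case: z => a b; exact: sqrtr_ge0. Qed.

Lemma normcX z n : normc (z ^+ n) = normc z ^+ n.
Proof.
elim: n => [|n IH]; first by rewrite !expr0 ComplexField.Normc.normc1.
by rewrite !exprS ComplexField.Normc.normcM IH.
Qed.

Lemma normc_real (a : R) : normc a%:C = `|a|.
Proof. by rewrite /= expr0n addr0 sqrtr_sqr. Qed.

Definition cmeasurable f :=
  measurable_fun setT (fun x => Re (f x)) /\
  measurable_fun setT (fun x => Im (f x)).

Lemma cmeasurable_cst c : cmeasurable (cst c).
Proof. by split; exact: measurable_cst. Qed.

Lemma cmeasurableM f g : cmeasurable f -> cmeasurable g ->
  cmeasurable (fun x => f x * g x).
Proof.
move=> [mf1 mf2] [mg1 mg2]; split.
  under eq_fun do rewrite Re_mul.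
  by apply: measurable_funB; exact: measurable_funM.
under eq_fun do rewrite Im_mul.
by apply: measurable_funD; exact: measurable_funM.
Qed.

Lemma cmeasurableX f n : cmeasurable f -> cmeasurable (fun x => f x ^+ n).
Proof.
move=> mf; elim: n => [|n IH].
  by under eq_fun do rewrite expr0; exact: cmeasurable_cst.
by under eq_fun do rewrite exprS; exact: cmeasurableM.
Qed.

Lemma measurable_sqr_normc f : cmeasurable f ->
  measurable_fun setT (fun x => normc (f x) ^+ 2).
Proof.
move=> [m1 m2]; under eq_fun do rewrite sqr_normcE.
by apply: measurable_funD; exact: measurable_funX.
Qed.

Lemma L2normE f :
  (L2norm f = (\int[mu]_x (normc (f x) ^+ 2)%:E) `^ 2^-1)%E.
Proof.
rewrite /L2norm unlock; congr (_ `^ _)%E; apply: eq_integral => x _.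
by rewrite abse_EFin poweR_EFin powR_mulrn// real_normK// num_real.
Qed.

Lemma in_L2P f :
  in_L2 f <-> cmeasurable f /\ (\int[mu]_x (normc (f x) ^+ 2)%:E < +oo)%E.
Proof.
split=> [[fr fi]|[[mr mi] finf]].
  have mf : cmeasurable f.
    by move: fr fi => /andP[/[!inE] m1 _] /andP[/[!inE] m2 _].
  split=> //.
  have /integrableP[_ h] := integrableD measurableT
    (Lfun2_integrable_sqr fr) (Lfun2_integrable_sqr fi).
  apply: le_lt_trans h; apply: ge0_le_integral => //.
  - by move=> x _; rewrite lee_fin sqr_ge0.
  - by apply/measurable_EFinP; exact: measurable_sqr_normc.
  - apply: measurableT_comp => //; case: mf => ? ?.
    by apply: emeasurable_funD; apply/measurable_EFinP; exact: measurable_funX.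
  - by move=> x _; rewrite sqr_normcE /= lee_fin ler_norm.
have aux (h : R -> R) : measurable_fun setT h ->
    (forall x, h x ^+ 2 <= normc (f x) ^+ 2) -> h \in Lfun mu 2%:E.
  move=> mh hf; rewrite inE; apply/andP; split; rewrite inE//=.
  rewrite /finite_norm unlock poweR_lty//; apply: le_lt_trans finf.
  under eq_integral => x _.
    by rewrite abse_EFin poweR_EFin powR_mulrn// real_normK ?num_real//; over.
  apply: ge0_le_integral => //.
  - by move=> x _; rewrite lee_fin sqr_ge0.
  - by apply/measurable_EFinP; exact: measurable_funX.
  - by apply/measurable_EFinP; exact: measurable_sqr_normc.
  - by move=> x _; rewrite /= lee_fin.
by split; apply: aux => // x; rewrite sqr_normcE; rewrite ?lerDl ?lerDr sqr_ge0.
Qed.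

Lemma in_L2_cmeasurable f : in_L2 f -> cmeasurable f.
Proof. by case/in_L2P. Qed.

Lemma in_L1P f : in_L1 f <->
  mu.-integrable setT (EFin \o (fun x => Re (f x))) /\
  mu.-integrable setT (EFin \o (fun x => Im (f x))).
Proof. by rewrite /in_L1 /in_Lp !Lfun1_integrable. Qed.

Lemma L2norm_fin f : in_L2 f -> L2norm f \is a fin_num.
Proof.
case/in_L2P => _ h; rewrite L2normE ge0_fin_numE ?poweR_ge0//.
exact: poweR_lty.
Qed.

Lemma in_L1B f g : in_L1 f -> in_L1 g -> in_L1 (fun x => f x - g x).
Proof.
rewrite !in_L1P => -[f1 f2] [g1 g2]; split.
  by under eq_fun do rewrite Re_sub; exact: (integrableB measurableT f1 g1).
by under eq_fun do rewrite Im_sub; exact: (integrableB measurableT f2 g2).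
Qed.

Lemma in_L2B f g : in_L2 f -> in_L2 g -> in_L2 (fun x => f x - g x).
Proof.
have aux (h k : R -> R) : h \in Lfun mu 2%:E -> k \in Lfun mu 2%:E ->
    (fun x => h x - k x) \in Lfun mu 2%:E.
  move=> hL kL; apply: (Lfun_addr_closed mu (lee1n 2)).2 => //.
  exact: Lfun_oppr_closed.
move=> [f1 f2] [g1 g2]; split.
  by under eq_fun do rewrite Re_sub; exact: aux.
by under eq_fun do rewrite Im_sub; exact: aux.
Qed.

End Complex.

(** * Linearity and dilation behaviour of the Fourier integral *)

Section Fourier.
Context {R : realType}.
Local Notation mu := (@lebesgue_measure R).
Implicit Types (f g : R -> R[i]) (c z : R[i]) (h : R -> R).

Lemma integrable_mul_bounded h (k : R -> R) :
  mu.-integrable setT (EFin \o h) -> measurable_fun setT k ->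
  (forall x, `|k x| <= 1) ->
  mu.-integrable setT (EFin \o (fun x => h x * k x)).
Proof.
move=> ih mk k1; apply: (le_integrable measurableT _ _ ih).
  apply/measurable_EFinP; apply: measurable_funM => //.
  by have /measurable_EFinP := measurable_int _ ih.
move=> x _ /=; rewrite lee_fin normrM ler_piMr//.
Qed.

Let integrable_sub h (k : R -> R) : mu.-integrable setT (EFin \o h) ->
  mu.-integrable setT (EFin \o k) ->
  mu.-integrable setT (EFin \o (fun x => h x - k x)).
Proof. by move=> ih ik; exact: (integrableB measurableT ih ik). Qed.

Let integrable_add h (k : R -> R) : mu.-integrable setT (EFin \o h) ->
  mu.-integrable setT (EFin \o k) ->
  mu.-integrable setT (EFin \o (fun x => h x + k x)).
Proof. by move=> ih ik; exact: (integrableD measurableT ih ik). Qed.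

Lemma in_L1_mul_expi f (xi : R) : in_L1 f ->
  in_L1 (fun x => f x * expi (- (xi * x))).
Proof.
rewrite !in_L1P => -[f1 f2].
have mc : measurable_fun setT (fun x : R => cos (- (xi * x))).
  apply: (measurableT_comp (continuous_measurable_fun (@continuous_cos R))).
  by apply: measurable_funN; exact: measurable_funM.
have ms : measurable_fun setT (fun x : R => sin (- (xi * x))).
  apply: (measurableT_comp (continuous_measurable_fun (@continuous_sin R))).
  by apply: measurable_funN; exact: measurable_funM.
have c1 x : `|cos (- (xi * x))| <= 1 :> R by rewrite ler_norml cos_geN1 cos_le1.
have s1 x : `|sin (- (xi * x))| <= 1 :> R by rewrite ler_norml sin_geN1 sin_le1.
split.
  under eq_fun do rewrite Re_mul.
  by apply: integrable_sub; exact: integrable_mul_bounded.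
under eq_fun do rewrite Im_mul.
by apply: integrable_add; exact: integrable_mul_bounded.
Qed.

Lemma CintegralB f g : in_L1 f -> in_L1 g ->
  Cintegral (fun x => f x - g x) = Cintegral f - Cintegral g.
Proof.
rewrite !in_L1P /Cintegral => -[f1 f2] [g1 g2].
by apply/eqP; rewrite eq_complex /=; apply/andP; split; apply/eqP;
  rewrite -RintegralB//; apply: eq_Rintegral => x _; rewrite ?Re_sub ?Im_sub.
Qed.

Lemma CintegralZ c f : in_L1 f ->
  Cintegral (fun x => c * f x) = c * Cintegral f.
Proof.
rewrite in_L1P /Cintegral => -[f1 f2].
have iz (a : R) (h : R -> R) : mu.-integrable setT (EFin \o h) ->
  mu.-integrable setT (EFin \o (fun x => a * h x)).
  by move=> ih; exact: (integrableZl measurableT a ih).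
apply/eqP; rewrite eq_complex Re_mul Im_mul /=; apply/andP; split; apply/eqP.
  rewrite -!RintegralZl// -RintegralB//; try exact: iz.
  by apply: eq_Rintegral => x _; rewrite Re_mul.
rewrite -!RintegralZl// -RintegralD//; try exact: iz.
by apply: eq_Rintegral => x _; rewrite Im_mul.
Qed.

Lemma Cintegral_dilation f (l : R) : 0 < l -> in_L1 f ->
  Cintegral (fun x => f (l * x)) = l^-1%:C * Cintegral f.
Proof.
move=> l0; rewrite in_L1P /Cintegral => -[f1 f2].
apply/eqP; rewrite eq_complex Re_mul Im_mul /= !mul0r subr0 addr0.
by rewrite (Rintegral_dilation l0 f1) (Rintegral_dilation l0 f2) !eqxx.
Qed.

Lemma in_L1_dilation f c (l : R) : 0 < l -> in_L1 f ->
  in_L1 (fun x => c * f (l * x)).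
Proof.
move=> l0; rewrite !in_L1P => -[f1 f2].
have iz (a : R) (h : R -> R) : mu.-integrable setT (EFin \o h) ->
  mu.-integrable setT (EFin \o (fun x => a * h (l * x))).
  by move=> ih; exact: (integrableZl measurableT a (integrable_dilation l0 ih)).
split.
  under eq_fun do rewrite Re_mul.
  exact: (integrable_sub (iz _ _ f1) (iz _ _ f2)).
under eq_fun do rewrite Im_mul.
exact: (integrable_add (iz _ _ f2) (iz _ _ f1)).
Qed.

Lemma fourier_integralB f g (xi : R) : in_L1 f -> in_L1 g ->
  fourier_integral (fun x => f x - g x) xi =
  fourier_integral f xi - fourier_integral g xi.
Proof.
move=> f1 g1; rewrite /fourier_integral -mulrBr; congr (_ * _).
under [in LHS]eq_fun do rewrite mulrBl.
by apply: CintegralB; exact: in_L1_mul_expi.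
Qed.

Lemma fourier_integral_dilation f c (l xi : R) : 0 < l -> in_L1 f ->
  fourier_integral (fun x => c * f (l * x)) xi =
  c * l^-1%:C * fourier_integral f (l^-1 * xi).
Proof.
move=> l0 f1; rewrite /fourier_integral.
pose g y := f y * expi (- (l^-1 * xi * y)).
have -> : (fun x => c * f (l * x) * expi (- (xi * x))) =
          (fun x => c * g (l * x)).
  apply/funext => x; rewrite /g -mulrA; congr (_ * (_ * expi (- _))).
  by rewrite mulrACA mulVf ?mul1r// gt_eqF.
have g1 : in_L1 g by exact: in_L1_mul_expi.
rewrite CintegralZ; last first.
  have := in_L1_dilation 1 l0 g1; by under eq_fun do rewrite mul1r.
by rewrite (Cintegral_dilation l0 g1); ring.
Qed.

Lemma sqr_normc_integral_dilation f c (l : R) : 0 < l -> cmeasurable f ->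
  (\int[mu]_x (normc (c * f (l * x)) ^+ 2)%:E =
   (normc c ^+ 2 / l)%:E * \int[mu]_x (normc (f x) ^+ 2)%:E)%E.
Proof.
move=> l0 mf; have mn := measurable_sqr_normc mf.
under eq_integral do rewrite ComplexField.Normc.normcM exprMn EFinM.
rewrite ge0_integralZl_EFin//; last 3 first.
- by move=> x _; rewrite lee_fin sqr_ge0.
- apply/measurable_EFinP.
  exact: (measurableT_comp mn (measurable_dilation l)).
- exact: sqr_ge0.
rewrite (ge0_integral_dilation (f := fun x => (normc (f x) ^+ 2)%:E) l0).
- by rewrite muleA -EFinM.
- exact/measurable_EFinP.
- by move=> x; rewrite lee_fin sqr_ge0.
Qed.

Lemma in_L2_dilation f c (l : R) : 0 < l -> in_L2 f ->
  in_L2 (fun x => c * f (l * x)).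
Proof.
move=> l0 /in_L2P[mf ff]; apply/in_L2P; split.
  apply: cmeasurableM; first exact: cmeasurable_cst.
  case: mf => m1 m2; split.
    exact: (measurableT_comp m1 (measurable_dilation l)).
  exact: (measurableT_comp m2 (measurable_dilation l)).
rewrite sqr_normc_integral_dilation// lte_mul_pinfty//.
by rewrite lee_fin divr_ge0// ?sqr_ge0 ?ltW.
Qed.

Lemma L2norm_dilation f c (l : R) : 0 < l -> cmeasurable f ->
  (L2norm (fun x => c * f (l * x))%R = (normc c / Num.sqrt l)%:E * L2norm f)%E.
Proof.
move=> l0 mf; rewrite !L2normE sqr_normc_integral_dilation//.
rewrite poweRM; last 2 first.
- by rewrite lee_fin divr_ge0// ?sqr_ge0 ?ltW.
- by apply: integral_ge0 => x _; rewrite lee_fin sqr_ge0.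
congr (_ * _)%E; rewrite poweR_EFin; congr _%:E.
rewrite powR12_sqrt ?divr_ge0 ?sqr_ge0 ?ltW// sqrtrM ?sqr_ge0//.
by rewrite sqrtr_sqr ger0_norm ?normc_ge0// sqrtrV// ltW.
Qed.

(** The constant sequence [f] approximates [f] in L^2. *)
Lemma is_fourier_integral f : in_L1 f -> in_L2 f ->
  in_L2 (fourier_integral f) -> is_fourier f (fourier_integral f).
Proof.
move=> f1 f2 F2; split=> //; exists (fun=> f).
have L0 g : L2norm (g \- g) = 0%E.
  rewrite L2normE (eq_integral (cst 0%E)); last first.
    by move=> x _; rewrite /= subrr ComplexField.Normc.normc0 expr0n.
  by rewrite integral0 poweR0r// invr_neq0.
by split=> //; under eq_fun do rewrite L0; exact: cvg_cst.
Qed.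

End Fourier.

(** * The functions x^k e^{-x} / k! on the half line *)

Section HalfLine.
Context {R : realType}.
Local Notation mu := (@lebesgue_measure R).
Local Notation half := (`[0, +oo[%classic : set R).

(** Half of the rate of [e^{-x}]: the other half absorbs the powers of [x]. *)
Definition decay (x : R) : R := expR (- (2^-1 * x)).

Lemma is_derive_decay (x : R) : is_derive x 1 decay (- 2^-1 * decay x).
Proof.
rewrite /decay; apply: is_derive_eq.
by rewrite -[_%:A]/(_ * 1); ring.
Qed.

Lemma continuous_decay : continuous decay.
Proof.
move=> x; apply: differentiable_continuous; apply/derivable1_diffP.
by have := is_derive_decay x; move=> /@ex_derive.
Qed.

Lemma decay_cvg0 : decay x @[x --> +oo] --> 0.
Proof.
apply: (@cvg_comp _ _ _ (fun x : R => 2^-1 * x) (fun x => expR (- x)) _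
  (pinfty_nbhs R)); last exact: cvgr_expR.
exact: gt0_cvgMry.
Qed.

Lemma integral_decay (C : R) : 0 <= C ->
  (\int[mu]_(x in half) (C * decay x)%:E = (2 * C)%:E)%E.
Proof.
move=> C0.
have dC (x : R) : is_derive x 1 (fun x : R => - 2 * C * decay x) (C * decay x).
  have := is_derive_decay x => ?; apply: is_derive_eq.
  by rewrite -[_ *: _]/(_ * _); lra.
rewrite (@ge0_continuous_FTC2y _ _ (fun x => - 2 * C * decay x) _ 0).
- by rewrite /decay mulr0 oppr0 expR0 mulr1 -EFinB; congr EFin; ring.
- by move=> x _; rewrite mulr_ge0// expR_ge0.
- apply: continuous_subspaceT => x; apply: cvgM; first exact: cvg_cst.
  exact: continuous_decay.
- rewrite -[X in _ --> X](mulr0 (- 2 * C)); apply: cvgM; first exact: cvg_cst.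
  exact: decay_cvg0.
- by move=> x _; exact: ex_derive.
- apply: cvg_at_right_filter; apply: cvgM; first exact: cvg_cst.
  exact: continuous_decay.
- by move=> x _; rewrite derive1E derive_val.
Qed.

Lemma integrable_decay_bound (h : R -> R) (C : R) : 0 <= C ->
  measurable_fun half h -> (forall x, 0 <= x -> `|h x| <= C * decay x) ->
  mu.-integrable half (EFin \o h).
Proof.
move=> C0 mh hC; apply/integrableP; split; first exact/measurable_EFinP.
apply: (@le_lt_trans _ _ (2 * C)%:E); last exact: ltry.
rewrite -integral_decay//; apply: ge0_le_integral => //.
- by apply: measurableT_comp => //; exact/measurable_EFinP.
- apply/measurable_EFinP; apply: measurable_funM => //.
  apply: measurable_funTS; apply: continuous_measurable_fun.
  exact: continuous_decay.
- by move=> x; rewrite /= in_itv/= andbT lee_fin => /hC.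
Qed.

(** The fundamental theorem of calculus on a half line, whose usual form asks
    for an integrand of constant sign, extends to dominated integrands: it holds
    for [C * decay] and for [h + C * decay], which are both nonnegative, hence
    for their difference [h]. *)
Lemma Rintegral_FTC_decay (h H : R -> R) (C : R) : 0 <= C ->
  continuous h -> (forall x : R, is_derive x 1 H (h x)) ->
  (forall x, 0 <= x -> `|h x| <= C * decay x) ->
  (forall x, 0 <= x -> `|H x| <= C * decay x) ->
  \int[mu]_(x in half) h x = - H 0.
Proof.
move=> C0 ch dH hC HC.
have cH : continuous H.
  move=> x; apply: differentiable_continuous; apply/derivable1_diffP.
  exact: ex_derive.
have ih : mu.-integrable half (EFin \o h).
  apply: (integrable_decay_bound C0) => //.
  by apply: measurable_funTS; exact: continuous_measurable_fun.
have cC : continuous (fun x => C * decay x).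
  move=> x; apply: cvgM; first exact: cvg_cst.
  exact: continuous_decay.
have ig : mu.-integrable half (EFin \o (fun x => C * decay x)).
  apply: (integrable_decay_bound C0).
    by apply: measurable_funTS; exact: continuous_measurable_fun.
  by move=> x _; rewrite ger0_norm// mulr_ge0// expR_ge0.
have Hcvg : H x @[x --> +oo] --> 0.
  have dec0 : C * decay x @[x --> +oo] --> 0.
    rewrite -[X in _ --> X](mulr0 C); apply: cvgM; first exact: cvg_cst.
    exact: decay_cvg0.
  apply: (@squeeze_cvgr _ _ _ _ (fun x => - (C * decay x))
    (fun x => C * decay x)) => //.
    near=> x; rewrite -ler_norml; apply: HC; near: x; exact: nbhs_pinfty_ge.
  by rewrite -oppr0; exact: cvgN.
have dG (x : R) :
    is_derive x 1 (fun x : R => H x + - 2 * C * decay x) (h x + C * decay x).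
  have ? := is_derive_decay x; have ? := dH x; apply: is_derive_eq.
  by rewrite -[_ *: _]/(_ * _); lra.
have E1 : (\int[mu]_(x in half) (h x + C * decay x)%:E = (- H 0 + 2 * C)%:E)%E.
  rewrite (@ge0_continuous_FTC2y _ _ (fun x => H x + - 2 * C * decay x) _ 0).
  - by rewrite /decay mulr0 oppr0 expR0 mulr1 -EFinB; congr EFin; ring.
  - move=> x /hC; rewrite ler_norml => /andP[+ _].
    by rewrite -subr_ge0 opprK addrC.
  - by apply: continuous_subspaceT => x; apply: cvgD; [exact: ch|exact: cC].
  - rewrite -[X in _ --> X]addr0 -[X in _ --> _ + X](mulr0 (- 2 * C)).
    apply: cvgD => //; apply: cvgM; first exact: cvg_cst.
    exact: decay_cvg0.
  - by move=> x _; exact: ex_derive.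
  - apply: cvg_at_right_filter; apply: cvgD; first exact: cH.
    by apply: cvgM; [exact: cvg_cst|exact: continuous_decay].
  - by move=> x _; rewrite derive1E derive_val.
have := @RintegralD _ _ _ mu half h (fun x => C * decay x)
  (measurable_itv _) ih ig.
by rewrite {1 3}/Rintegral integral_decay// E1 /=; lra.
Unshelve. all: by end_near.
Qed.

(** The density of the Gamma law of shape [k + 1] and rate 1 on the half line;
    the factorial makes the relation [gamma_pdf k.+1' = gamma_pdf k -
    gamma_pdf k.+1] free of coefficients. *)
Definition gamma_pdf (k : nat) (x : R) : R := k`!%:R^-1 * (x ^+ k * expR (- x)).

Definition dgamma_pdf (k : nat) (x : R) : R :=
  (if k is j.+1 then gamma_pdf j x else 0) - gamma_pdf k x.

Lemma is_derive_gamma_pdf k (x : R) :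
  is_derive x 1 (gamma_pdf k) (dgamma_pdf k x).
Proof.
have dE : is_derive x 1 (fun x : R => expR (- x)) (- expR (- x)).
  by apply: is_derive_eq; rewrite mulrN mulr1.
case: k => [|k].
  have -> : gamma_pdf 0 = fun x => expR (- x).
    by apply/funext => y; rewrite /gamma_pdf fact0 invr1 mul1r expr0 mul1r.
  by rewrite /dgamma_pdf sub0r /gamma_pdf fact0 invr1 mul1r expr0 mul1r.
have dX : is_derive x 1 (fun y : R => y ^+ k.+1) (k.+1%:R * x ^+ k).
  have := is_deriveX k.+1 (is_derive_id x (1 : R)).
  by rewrite fctE -[_ *: _]/(_ * 1) mulr1.
rewrite /dgamma_pdf /gamma_pdf; apply: is_derive_eq.
rewrite /gamma_pdf factS natrM -![_ *: _]/(_ * _).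
have k1 : k.+1%:R != 0 :> R by rewrite pnatr_eq0.
have k2 : k`!%:R != 0 :> R by rewrite pnatr_eq0 -lt0n fact_gt0.
rewrite exprS; move: (_.+1%:R) k1 (_`!%:R) k2 => a a0 b b0.
by field; rewrite a0 b0.
Qed.

Lemma gamma_pdf_ge0 k (x : R) : 0 <= x -> 0 <= gamma_pdf k x.
Proof.
move=> x0; rewrite /gamma_pdf.
by rewrite !mulr_ge0 ?expR_ge0 ?exprn_ge0 ?invr_ge0 ?ler0n.
Qed.

(** [(x / 2) ^ k / k!] is one term of the series of [e^{x/2}]. *)
Lemma gamma_pdf_le_decay k (x : R) :
  0 <= x -> gamma_pdf k x <= 2 ^+ k * decay x.
Proof.
move=> x0.
have h : (2^-1 * x) ^+ k / k`!%:R <= expR (2^-1 * x).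
  case: k => [|k].
    by rewrite expr0 fact0 divr1 -(expR0 R) ler_expR mulr_ge0.
  have := expR_ge1Dxn k (mulr_ge0 (_ : 0 <= 2^-1) x0).
  rewrite invr_ge0 ler0n => /(_ isT).
  by apply: le_trans; rewrite lerDr.
have -> : gamma_pdf k x = 2 ^+ k * ((2^-1 * x) ^+ k / k`!%:R * expR (- x)).
  have : 2 ^+ k != 0 :> R by rewrite expf_neq0// pnatr_eq0.
  rewrite /gamma_pdf exprMn exprVn; move: (2 ^+ k) => a a0.
  rewrite !mulrA mulfV// mul1r.
  by rewrite (mulrC _^-1).
rewrite ler_wpM2l ?exprn_ge0//.
apply: (le_trans (ler_wpM2r (expR_ge0 _) h)).
by rewrite -expRD /decay ler_expR; lra.
Qed.

Lemma normr_gamma_pdf_le k (x : R) :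
  0 <= x -> `|gamma_pdf k x| <= 2 ^+ k * decay x.
Proof. by move=> x0; rewrite ger0_norm ?gamma_pdf_ge0// gamma_pdf_le_decay. Qed.

Lemma continuous_gamma_pdf k : continuous (gamma_pdf k).
Proof.
move=> x; apply: differentiable_continuous; apply/derivable1_diffP.
by have ? := is_derive_gamma_pdf k x; exact: ex_derive.
Qed.

Lemma integrable_gamma_pdf k (t : R -> R) :
  continuous t -> (forall x, `|t x| <= 1) ->
  mu.-integrable half (EFin \o (fun x => gamma_pdf k x * t x)).
Proof.
move=> ct t1; apply: (@integrable_decay_bound _ (2 ^+ k)).
  exact: exprn_ge0.
  apply: measurable_funTS; apply: continuous_measurable_fun => x.
  by apply: cvgM; [exact: continuous_gamma_pdf|exact: ct].
move=> x x0; rewrite normrM; apply: le_trans (normr_gamma_pdf_le k x0).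
by rewrite ler_piMr.
Qed.

(** The product of [gamma_pdf k] and [t] tends to 0 at infinity because [t] is
    bounded, so the boundary term at 0 is the only one. *)
Lemma Rintegral_gamma_pdf_parts k (t t' : R -> R) (B : R) :
  (forall x : R, is_derive x 1 t (t' x)) -> continuous t' ->
  (forall x, `|t x| <= 1) -> (forall x, `|t' x| <= B) ->
  \int[mu]_(x in half) (dgamma_pdf k x * t x + gamma_pdf k x * t' x) =
  - (gamma_pdf k 0 * t 0).
Proof.
move=> dt ct' t1 t'B.
have B0 : 0 <= B by apply: le_trans (t'B 0).
have ct : continuous t.
  move=> x; apply: differentiable_continuous; apply/derivable1_diffP.
  by have ? := dt x; exact: ex_derive.
have dgb x : 0 <= x -> `|dgamma_pdf k x| <= (2 ^+ k + 2 ^+ k) * decay x.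
  move=> x0; apply: (le_trans (ler_normB _ _)).
  rewrite mulrDl lerD ?normr_gamma_pdf_le//.
  case: k => [|k]; first by rewrite normr0 mulr_ge0 ?exprn_ge0 ?expR_ge0.
  apply: (le_trans (normr_gamma_pdf_le _ x0)); rewrite ler_wpM2r ?expR_ge0//.
  by rewrite ler_eXn2l ?ltr1n.
have cdg : continuous (dgamma_pdf k).
  move=> x; rewrite /dgamma_pdf; apply: cvgB; last exact: continuous_gamma_pdf.
  by case: k {dgb} => [|k]; [exact: cvg_cst|exact: continuous_gamma_pdf].
apply: (@Rintegral_FTC_decay _ (fun x => gamma_pdf k x * t x)
  ((2 ^+ k + 2 ^+ k) + 2 ^+ k * B)).
- by rewrite !addr_ge0 ?mulr_ge0 ?exprn_ge0.
- move=> x; apply: cvgD; apply: cvgM; [exact: cdg|exact: ct| |exact: ct'].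
  exact: continuous_gamma_pdf.
- move=> x; have ? := is_derive_gamma_pdf k x; have ? := dt x.
  apply: is_derive_eq.
  by rewrite -![_ *: _]/(_ * _) addrC mulrC.
- move=> x x0; apply: (le_trans (ler_normD _ _)); rewrite [leRHS]mulrDl.
  apply: lerD; rewrite [leLHS]normrM.
    by apply: le_trans (dgb _ x0); rewrite ler_piMr.
  by rewrite mulrAC ler_pM ?normr_gamma_pdf_le.
- move=> x x0; rewrite [leLHS]normrM.
  apply: (@le_trans _ _ (2 ^+ k * decay x)).
    by apply: le_trans (normr_gamma_pdf_le k x0); rewrite ler_piMr.
  by rewrite ler_wpM2r ?expR_ge0// -addrA lerDl addr_ge0 ?mulr_ge0 ?exprn_ge0.
Qed.

End HalfLine.

(** * Fourier transforms of the profiles and of their derivatives *)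

Section WavePacket.
Context {R : realType}.
Local Notation mu := (@lebesgue_measure R).
Local Notation half := (`[0, +oo[%classic : set R).

Definition gamma_wave (k : nat) (x : R) : R[i] :=
  if 0 <= x then (gamma_pdf k x)%:C else 0.

Lemma Re_gamma_wave k : (fun x => Re (gamma_wave k x)) = gamma_pdf k \_ half.
Proof.
apply/funext => x; rewrite /gamma_wave patchE mem_setE in_itv/= andbT.
by case: ifP.
Qed.

Lemma Im_gamma_wave k : (fun x => Im (gamma_wave k x)) = cst 0.
Proof. by apply/funext => x; rewrite /gamma_wave; case: ifP. Qed.

Lemma measurable_gamma_pdf_half k : measurable_fun setT (gamma_pdf k \_ half).
Proof.
apply/measurable_restrict => //; apply: measurable_funTS.
by apply: continuous_measurable_fun; exact: continuous_gamma_pdf.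
Qed.

Lemma gamma_wave_in_L1 k : in_L1 (gamma_wave k).
Proof.
apply/in_L1P; rewrite Re_gamma_wave Im_gamma_wave.
split; last exact: integrable0.
rewrite -restrict_EFin; apply/integrable_restrict => //; rewrite setTI.
apply: eq_integrable (@integrable_gamma_pdf R k (cst 1) _ _) => //.
- by move=> x _ /=; rewrite mulr1.
- by move=> ?; exact: cvg_cst.
- by move=> x; rewrite normr1.
Qed.

Lemma gamma_wave_in_L2 k : in_L2 (gamma_wave k).
Proof.
apply/in_L2P; split.
  split; rewrite ?Re_gamma_wave ?Im_gamma_wave.
    exact: measurable_gamma_pdf_half.
  exact: measurable_cst.
have -> : (fun x => (normc (gamma_wave k x) ^+ 2)%:E) =
          (EFin \o (fun x => gamma_pdf k x * gamma_pdf k x)) \_ half.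
  apply/funext => x; rewrite /gamma_wave patchE mem_setE in_itv/= andbT.
  case: ifP => _; last by rewrite ComplexField.Normc.normc0 expr0n.
  by rewrite normc_real real_normK ?num_real.
rewrite -integral_mkcond.
have : mu.-integrable half (EFin \o (fun x => gamma_pdf k x * gamma_pdf k x)).
  apply: (@integrable_decay_bound _ _ (2 ^+ k * 2 ^+ k)).
  - by rewrite mulr_ge0 ?exprn_ge0.
  - apply: measurable_funTS; apply: continuous_measurable_fun => x.
    by apply: cvgM; exact: continuous_gamma_pdf.
  - move=> x x0; rewrite normrM -mulrA ler_pM ?normr_gamma_pdf_le//.
    apply: (le_trans (normr_gamma_pdf_le _ x0)).
    rewrite ler_piMr ?exprn_ge0// /decay -(expR0 R) ler_expR oppr_le0.
    by rewrite mulr_ge0.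
move=> /integrableP[_]; apply: le_lt_trans; apply: ge0_le_integral => //.
- by move=> x _; rewrite lee_fin -expr2 sqr_ge0.
- apply/measurable_EFinP; apply: measurable_funTS.
  apply: continuous_measurable_fun => x.
  by apply: cvgM; exact: continuous_gamma_pdf.
- apply: measurableT_comp => //; apply/measurable_EFinP.
  apply: measurable_funTS.
  apply: continuous_measurable_fun => x.
  by apply: cvgM; exact: continuous_gamma_pdf.
- by move=> x _; rewrite lee_fin ler_norm.
Qed.

Definition gamma_pdf_cos k (xi : R) :=
  \int[mu]_(x in half) (gamma_pdf k x * cos (- (xi * x))).

Definition gamma_pdf_sin k (xi : R) :=
  \int[mu]_(x in half) (gamma_pdf k x * sin (- (xi * x))).

Lemma Cintegral_gamma_wave k (xi : R) :
  Cintegral (fun x => gamma_wave k x * expi (- (xi * x))) =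
  gamma_pdf_cos k xi +i* gamma_pdf_sin k xi.
Proof.
rewrite /Cintegral /gamma_pdf_cos /gamma_pdf_sin !(Rintegral_mkcond mu half).
congr (_ +i* _); apply: eq_Rintegral => x _;
  rewrite ?Re_mul ?Im_mul patchE mem_setE in_itv/= andbT /gamma_wave;
  by case: ifP => _ /=; rewrite ?mul0r ?subr0 ?addr0.
Qed.

Let trig (xi : R) : [/\ continuous (fun x : R => cos (- (xi * x))),
  continuous (fun x : R => sin (- (xi * x))),
  forall x : R,
    is_derive x 1 (fun x : R => cos (- (xi * x))) (xi * sin (- (xi * x))) &
  forall x : R,
    is_derive x 1 (fun x : R => sin (- (xi * x))) (- xi * cos (- (xi * x)))].
Proof.
have dc (x : R) :
    is_derive x 1 (fun x : R => cos (- (xi * x))) (xi * sin (- (xi * x))).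
  by apply: is_derive_eq; rewrite -[_%:A]/(_ * 1); ring.
have ds (x : R) :
    is_derive x 1 (fun x : R => sin (- (xi * x))) (- xi * cos (- (xi * x))).
  by apply: is_derive_eq; rewrite -[_%:A]/(_ * 1); ring.
split => // x; apply: differentiable_continuous; apply/derivable1_diffP.
  by have ? := dc x; exact: ex_derive.
by have ? := ds x; exact: ex_derive.
Qed.

Let cos1 (x : R) : `|cos x| <= 1.
Proof. by rewrite ler_norml cos_geN1 cos_le1. Qed.
Let sin1 (x : R) : `|sin x| <= 1.
Proof. by rewrite ler_norml sin_geN1 sin_le1. Qed.

(** With [e_xi x = e^{-(1 + i xi) x}], the factor [1 + i xi] comes from
    differentiating [e_xi], and integration by parts moves the derivative to
    [x^k / k!].  For [k = 0] only the boundary term at 0 is left.  The proof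
    splits into real and imaginary parts. *)
Lemma gamma_fourier_rec k (xi : R) :
  (1 +i* xi) * (gamma_pdf_cos k xi +i* gamma_pdf_sin k xi) =
  if k is j.+1 then gamma_pdf_cos j xi +i* gamma_pdf_sin j xi else 1.
Proof.
have [cc cs dc ds] := trig xi.
have ic j : mu.-integrable half
    (EFin \o (fun x => gamma_pdf j x * cos (- (xi * x)))).
  exact: integrable_gamma_pdf.
have is_ j : mu.-integrable half
    (EFin \o (fun x => gamma_pdf j x * sin (- (xi * x)))).
  exact: integrable_gamma_pdf.
have iZ (a : R) (h : R -> R) : mu.-integrable half (EFin \o h) ->
    mu.-integrable half (EFin \o (fun x => a * h x)).
  by move=> ih; apply: (integrableZl _ a ih).
have iB (h1 h2 : R -> R) : mu.-integrable half (EFin \o h1) ->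
    mu.-integrable half (EFin \o h2) ->
    mu.-integrable half (EFin \o (fun x => h1 x - h2 x)).
  by move=> i1 i2; apply: (integrableB _ i1 i2).
have RB (h1 h2 : R -> R) : mu.-integrable half (EFin \o h1) ->
    mu.-integrable half (EFin \o h2) ->
    \int[mu]_(x in half) (h1 x - h2 x) =
    \int[mu]_(x in half) h1 x - \int[mu]_(x in half) h2 x.
  by move=> i1 i2; apply: RintegralB.
have RD (h1 h2 : R -> R) : mu.-integrable half (EFin \o h1) ->
    mu.-integrable half (EFin \o h2) ->
    \int[mu]_(x in half) (h1 x + h2 x) =
    \int[mu]_(x in half) h1 x + \int[mu]_(x in half) h2 x.
  by move=> i1 i2; apply: RintegralD.
have RZ (a : R) (h : R -> R) : mu.-integrable half (EFin \o h) ->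
    \int[mu]_(x in half) (a * h x) = a * \int[mu]_(x in half) h x.
  by move=> ih; apply: RintegralZl.
pose prec (t : R -> R) x :=
  if k is j.+1 then gamma_pdf j x * t (- (xi * x)) else 0.
have ip t : (forall j, mu.-integrable half
      (EFin \o (fun x => gamma_pdf j x * t (- (xi * x))))) ->
    mu.-integrable half (EFin \o (prec t)).
  by rewrite /prec; case: (k) => [|j] // _; exact: integrable0.
have Hc : \int[mu]_(x in half) (prec cos x) - gamma_pdf_cos k xi +
    xi * gamma_pdf_sin k xi = - gamma_pdf k 0.
  have := @Rintegral_gamma_pdf_parts R k _ _ `|xi| dc.
  rewrite mulr0 oppr0 cos0 mulr1 => <-.
  - rewrite /gamma_pdf_cos /gamma_pdf_sin -RB//; [|exact: ip].
    rewrite -RZ// -RD//; [|exact/iB/ic/ip|exact: iZ].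
    apply: eq_Rintegral => x _; rewrite /prec /dgamma_pdf.
    by case: (k) => [|j]; ring.
  - by move=> x; apply: cvgM; [exact: cvg_cst|exact: cs].
  - by move=> x; exact: cos1.
  - by move=> x; rewrite normrM ler_piMr.
have Hs : \int[mu]_(x in half) (prec sin x) - gamma_pdf_sin k xi -
    xi * gamma_pdf_cos k xi = 0.
  have := @Rintegral_gamma_pdf_parts R k _ _ `|xi| ds.
  rewrite mulr0 oppr0 sin0 mulr0 oppr0 => E; rewrite -[RHS]E.
  - rewrite /gamma_pdf_cos /gamma_pdf_sin -RB//; [|exact: ip].
    rewrite -RZ// -RB//; [|exact/iB/is_/ip|exact: iZ].
    apply: eq_Rintegral => x _; rewrite /prec /dgamma_pdf.
    by case: (k) => [|j]; ring.
  - by move=> x; apply: cvgM; [exact: cvg_cst|exact: cc].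
  - by move=> x; exact: sin1.
  - by move=> x; rewrite normrM normrN ler_piMr.
rewrite /prec in Hc Hs.
apply/eqP; rewrite eq_complex Re_mul Im_mul /=.
case: k Hc Hs {ip prec} => [|k] /=;
  rewrite -/(gamma_pdf_cos _ _) -/(gamma_pdf_sin _ _).
  rewrite !Rintegral_cst // !mul0r /gamma_pdf fact0 invr1 expr0 oppr0 expR0.
  rewrite !mul1r.
  by move=> Hc Hs; apply/andP; split; apply/eqP; lra.
rewrite /gamma_pdf expr0n /= mul0r mulr0 oppr0.
by move=> Hc Hs; apply/andP; split; apply/eqP; lra.
Qed.

Lemma oneDi_neq0 (xi : R) : 1 +i* xi != 0.
Proof. by rewrite eq_complex /= oner_eq0. Qed.

Definition gamma_hat k (xi : R) : R[i] :=
  (Num.sqrt (2 * pi))^-1%:C * ((1 +i* xi) ^+ k.+1)^-1.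

Lemma fourier_gamma_wave k (xi : R) :
  fourier_integral (gamma_wave k) xi = gamma_hat k xi.
Proof.
rewrite /fourier_integral /gamma_hat Cintegral_gamma_wave; congr (_ * _).
elim: k => [|k IH].
  by rewrite -[LHS](mulKf (oneDi_neq0 xi)) gamma_fourier_rec mulr1 expr1.
rewrite -[LHS](mulKf (oneDi_neq0 xi)) gamma_fourier_rec IH.
by rewrite [in RHS]exprS invfM.
Qed.

(** For [p <= k] this is the [p]-th weak derivative of [gamma_wave k]: the
    recurrence iterates [gamma_wave k.+1' = gamma_wave k - gamma_wave k.+1]. *)
Fixpoint gamma_deriv (p k : nat) : R -> R[i] :=
  if p is q.+1 then fun x => gamma_deriv q k.-1 x - gamma_deriv q k x
  else gamma_wave k.

Lemma gamma_deriv_in_L1 p k : in_L1 (gamma_deriv p k).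
Proof.
elim: p k => [|p IH] k; first exact: gamma_wave_in_L1.
exact: in_L1B.
Qed.

Lemma gamma_deriv_in_L2 p k : in_L2 (gamma_deriv p k).
Proof.
elim: p k => [|p IH] k; first exact: gamma_wave_in_L2.
exact: in_L2B.
Qed.

(** Each difference multiplies the transform by [(1 + i xi) - 1]. *)
Lemma fourier_gamma_deriv p k (xi : R) : (p <= k)%N ->
  fourier_integral (gamma_deriv p k) xi = (0 +i* xi) ^+ p * gamma_hat k xi.
Proof.
elim: p k => [|p IH] k pk; first by rewrite expr0 mul1r -fourier_gamma_wave.
case: k pk => [//|k] pk /=.
rewrite fourier_integralB; [|exact: gamma_deriv_in_L1..].
rewrite !IH //; last exact: ltnW.
rewrite exprSr -mulrA -mulrBr; congr (_ * _).
rewrite /gamma_hat mulrCA -mulrBr; congr (_ * _).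
have -> : 0 +i* xi = (1 +i* xi) - 1 :> R[i].
  by apply/eqP; rewrite eq_complex /= !subr0 subrr !eqxx.
have z0 := oneDi_neq0 xi; rewrite !(exprS _ k.+1).
by field; rewrite z0 expf_neq0.
Qed.

Lemma sqr_normc_oneDi (xi : R) : normc (1 +i* xi) ^+ 2 = 1 + xi ^+ 2.
Proof. by rewrite sqr_normcE /= expr1n. Qed.

Lemma sqr_normc_gamma_hat k (xi : R) :
  normc (gamma_hat k xi) ^+ 2 = (2 * pi)^-1 / (1 + xi ^+ 2) ^+ k.+1.
Proof.
rewrite /gamma_hat ComplexField.Normc.normcM exprMn normc_real.
rewrite real_normK ?num_real//.
rewrite exprVn sqr_sqrtr ?mulr_ge0 ?pi_ge0// ComplexField.Normc.normcV normcX.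
by rewrite -exprVn exprAC exprVn sqr_normc_oneDi -exprVn.
Qed.

Lemma cmeasurable_gamma_hat k : cmeasurable (@gamma_hat k).
Proof.
apply: cmeasurableM; first exact: cmeasurable_cst.
under eq_fun do rewrite -exprVn.
apply: cmeasurableX.
have E (x : R) : (1 +i* x)^-1 = (1 / (1 + x ^+ 2)) -i* (x / (1 + x ^+ 2)).
  by rewrite /GRing.inv /= expr1n.
have c : continuous (fun x : R => (1 + x ^+ 2)^-1).
  exact: continuous_oneDsqrV.
split; under eq_fun do rewrite E /=.
  under eq_fun do rewrite mul1r.
  exact: continuous_measurable_fun.
apply: measurable_funN; apply: measurable_funM => //.
exact: continuous_measurable_fun.
Qed.

Lemma cmeasurable_derivative_symbol p (F : R -> R[i]) :
  cmeasurable F -> cmeasurable (fun xi => (0 +i* xi) ^+ p * F xi).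
Proof.
move=> mF; apply: cmeasurableM => //; apply: cmeasurableX.
by split=> /=; [exact: measurable_cst|exact: measurable_id].
Qed.

Lemma integral_oneDsqrV_lty (C : R) : 0 <= C ->
  (\int[mu]_x (C * (1 + x ^+ 2)^-1)%:E < +oo)%E.
Proof.
move=> C0; under eq_integral do rewrite EFinM.
have mV : measurable_fun setT (fun x : R => (1 + x ^+ 2)^-1).
  by apply: continuous_measurable_fun; exact: continuous_oneDsqrV.
rewrite ge0_integralZl_EFin//; last 2 first.
- by move=> x _; rewrite lee_fin invr_ge0 addr_ge0// sqr_ge0.
- exact/measurable_EFinP.
rewrite lte_mul_pinfty//.
rewrite (@ge0_symfun_integralT _ (fun x : R => (1 + x ^+ 2)^-1)).
- rewrite -set_itvcy integral0y_oneDsqr -EFinM; exact: ltry.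
- by move=> x; rewrite invr_ge0 addr_ge0// sqr_ge0.
- exact: continuous_oneDsqrV.
- by move=> x /=; rewrite sqrrN.
Qed.

(** Of the [k + 1] factors [1 + x^2] in the denominator, [k] compensate the
    weight, and the last one makes the integral converge. *)
Lemma integral_sqr_gamma_hat_lty k (w : R -> R) : measurable_fun setT w ->
  (forall x, 0 <= w x) -> (forall x, w x <= (1 + x ^+ 2) ^+ k) ->
  (\int[mu]_x (w x * normc (gamma_hat k x) ^+ 2)%:E < +oo)%E.
Proof.
move=> mw w0 wk.
apply: le_lt_trans (@integral_oneDsqrV_lty (2 * pi)^-1 _); last first.
  by rewrite invr_ge0 mulr_ge0// pi_ge0.
apply: ge0_le_integral => //.
- by move=> x _; rewrite lee_fin mulr_ge0// sqr_ge0.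
- apply/measurable_EFinP; apply: measurable_funM => //.
  apply: measurable_sqr_normc; exact: cmeasurable_gamma_hat.
- apply/measurable_EFinP; apply: measurable_funM => //.
  by apply: continuous_measurable_fun; exact: continuous_oneDsqrV.
move=> x _; rewrite lee_fin sqr_normc_gamma_hat mulrCA ler_wpM2l//.
  by rewrite invr_ge0 mulr_ge0// pi_ge0.
have x0 : 0 < 1 + x ^+ 2 by rewrite ltr_pwDl// sqr_ge0.
rewrite exprSr invfM mulrA -[leRHS]mul1r ler_wpM2r ?invr_ge0 ?(ltW x0)//.
by rewrite ler_pdivrMr ?exprn_gt0// mul1r.
Qed.

Lemma gamma_deriv_hat_in_L2 p k : (p <= k)%N ->
  in_L2 (fun xi => (0 +i* xi) ^+ p * gamma_hat k xi).
Proof.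
move=> pk; apply/in_L2P; split.
  apply: cmeasurable_derivative_symbol; exact: cmeasurable_gamma_hat.
under eq_integral do rewrite ComplexField.Normc.normcM exprMn.
apply: integral_sqr_gamma_hat_lty => [||x].
- apply: measurable_sqr_normc; apply: cmeasurableX.
  by split=> /=; [exact: measurable_cst|exact: measurable_id].
- by move=> x; exact: sqr_ge0.
rewrite normcX exprAC sqr_normcE /= expr0n add0r.
have le1 : 1 <= 1 + x ^+ 2 by rewrite lerDl sqr_ge0.
apply: (@le_trans _ _ ((1 + x ^+ 2) ^+ p)).
  by rewrite lerXn2r ?nnegrE ?sqr_ge0 ?(le_trans ler01)// lerDr.
by rewrite ler_weXn2l.
Qed.

End WavePacket.

(** * Null functions, and the Sobolev norm of a dilate *)

Section NullSobolev.
Context {R : realType}.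
Local Notation mu := (@lebesgue_measure R).
Implicit Types (f g F : R -> R[i]) (c : R[i]).

Let ae_imp (P Q : R -> Prop) : (forall x, P x -> Q x) ->
  {ae mu, forall x, P x} -> {ae mu, forall x, Q x}.
Proof. exact: (@filterS _ _ (ae_filter_ringOfSetsType mu)). Qed.

Lemma L2norm_ae f g : cmeasurable f -> cmeasurable g -> ae_equal f g ->
  L2norm f = L2norm g.
Proof.
move=> mf mg fg; rewrite !L2normE; congr (_ `^ _)%E.
apply: ge0_ae_eq_integral => //.
- by apply/measurable_EFinP; exact: measurable_sqr_normc.
- by apply/measurable_EFinP; exact: measurable_sqr_normc.
- by move=> x _; rewrite lee_fin sqr_ge0.
- by move=> x _; rewrite lee_fin sqr_ge0.
- by move: fg; apply: ae_imp => x /= -> _.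
Qed.

Lemma in_L2_zero : in_L2 (fun=> 0 : R[i]).
Proof.
apply/in_L2P; split; first exact: cmeasurable_cst.
under eq_integral do rewrite ComplexField.Normc.normc0 expr0n.
by rewrite integral0.
Qed.

Lemma L2op_zero (A : (R -> R[i]) -> (R -> R[i])) :
  L2_linear_operator A -> ae_equal (A (fun=> 0)) (fun=> 0).
Proof.
move=> LA; have := L2op_linear LA (-1) in_L2_zero in_L2_zero.
have -> : (fun x : R => -1 * 0 + 0) = (fun=> 0) :> (R -> R[i]).
  by apply/funext => x; rewrite mulr0 addr0.
by apply: ae_imp => x ->; rewrite mulN1r addNr.
Qed.

Lemma L2norm_eq0_ae f : cmeasurable f -> L2norm f = 0%E ->
  ae_equal f (fun=> 0).
Proof.
move=> mf; rewrite L2normE => /poweR_eq0_eq0 h.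
have {}h : (\int[mu]_x `|(normc (f x) ^+ 2)%:E| = 0)%E.
  rewrite -[RHS]h; last by apply: integral_ge0 => x _; rewrite lee_fin sqr_ge0.
  by apply: eq_integral => x _; rewrite gee0_abs// lee_fin sqr_ge0.
have /(ae_eq_integral_abs mu measurableT) := h.
have mn : measurable_fun setT (fun x => (normc (f x) ^+ 2)%:E).
  by apply/measurable_EFinP; exact: measurable_sqr_normc.
move=> /(_ mn); apply: ae_imp => x /(_ I) /eqP.
by rewrite eqe sqrf_eq0 => /eqP /ComplexField.Normc.eq0_normc.
Qed.

Lemma Cintegral_ae0 f :
  cmeasurable f -> ae_equal f (fun=> 0) -> Cintegral f = 0.
Proof.
move=> [mr mi] f0; rewrite /Cintegral /Rintegral.
have aux (h : R -> R) : measurable_fun setT h ->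
    {ae mu, forall x, h x = 0} -> (\int[mu]_x (h x)%:E = 0)%E.
  move=> mh h0; rewrite (ae_eq_integral (cst 0%E)) ?integral0//.
    exact/measurable_EFinP.
  by move: h0; apply: ae_imp => x -> _.
by rewrite !aux//; move: f0; apply: ae_imp => x ->.
Qed.

(** A function of norm 0 has an identically vanishing Fourier integral, but
    that of [gamma_deriv p k] does not vanish at the frequency 1. *)
Lemma L2norm_gamma_deriv_neq0 p k :
  (p <= k)%N -> L2norm (@gamma_deriv R p k) != 0%E.
Proof.
move=> pk; apply/eqP => /L2norm_eq0_ae w0.
have {}w0 := w0 (in_L2_cmeasurable (gamma_deriv_in_L2 p k)).
have := fourier_gamma_deriv (1 : R) pk.
rewrite /fourier_integral Cintegral_ae0; last 2 first.
- have /in_L1P[h1 h2] := in_L1_mul_expi (1 : R) (@gamma_deriv_in_L1 R p k).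
  split; apply/measurable_EFinP; first exact: measurable_int h1.
  exact: measurable_int h2.
- by move: w0; apply: ae_imp => x ->; rewrite mul0r.
rewrite mulr0 => /esym/eqP.
rewrite mulf_eq0 expf_eq0 eq_complex /= oner_eq0 !andbF /=.
rewrite /gamma_hat mulf_eq0 invr_eq0 expf_eq0 (negPf (oneDi_neq0 _)) andbF orbF.
by rewrite eq_complex /= eqxx andbT invr_eq0 sqrtr_eq0 leNgt mulr_gt0// ?pi_gt0.
Qed.

(** After the substitution [x = l * y] the weight [1 + (l * y)^2] is at most
    [l^2 * (1 + y^2)], because [1 <= l]. *)
Lemma sobolev_integral_dilation F c (s l : R) : 0 <= s -> 1 <= l ->
  cmeasurable F ->
  (\int[mu]_x ((1 + x ^+ 2) `^ s * normc (c * F (l^-1 * x)) ^+ 2)%:E <=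
   (normc c ^+ 2 * l * (l `^ s) ^+ 2)%:E *
   \int[mu]_x ((1 + x ^+ 2) `^ s * normc (F x) ^+ 2)%:E)%E.
Proof.
move=> s0 l1 mF; have l0 : 0 < l := lt_le_trans ltr01 l1.
have mw (r : R) : measurable_fun setT (fun x : R => (1 + (r * x) ^+ 2) `^ s).
  apply: (measurableT_comp (measurable_powR s)).
  apply: measurable_funD => //; apply: measurable_funX.
  exact: measurable_dilation.
have mn := measurable_sqr_normc mF.
pose g x := (1 + (l * x) ^+ 2) `^ s * normc (c * F x) ^+ 2.
have mg : measurable_fun setT g.
  apply: measurable_funM => //.
  under eq_fun do rewrite ComplexField.Normc.normcM exprMn.
  exact: measurable_funM.
have -> : (fun x => ((1 + x ^+ 2) `^ s * normc (c * F (l^-1 * x)) ^+ 2)%:E) =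
          (fun x => (EFin \o g) (l^-1 * x)).
  by apply/funext => x /=; rewrite /g mulVKf ?gt_eqF.
rewrite (@ge0_integral_dilation _ l^-1 (EFin \o g)) ?invr_gt0//; last 2 first.
- exact/measurable_EFinP.
- by move=> x; rewrite lee_fin mulr_ge0 ?powR_ge0 ?sqr_ge0.
rewrite invrK -(mulrC l) -mulrA EFinM -muleA lee_wpmul2l// ?lee_fin ?(ltW l0)//.
have mw1 : measurable_fun setT (fun x : R => (1 + x ^+ 2) `^ s).
  by have := mw 1; under eq_fun do rewrite mul1r.
rewrite -ge0_integralZl_EFin//; last 3 first.
- by move=> x _; rewrite lee_fin mulr_ge0 ?powR_ge0 ?sqr_ge0.
- by apply/measurable_EFinP; exact: measurable_funM.
- by rewrite mulr_ge0 ?sqr_ge0.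
apply: ge0_le_integral => //.
- by move=> x _; rewrite lee_fin mulr_ge0 ?powR_ge0 ?sqr_ge0.
- exact/measurable_EFinP.
- apply: emeasurable_funM => //; apply/measurable_EFinP; exact: measurable_funM.
move=> x _; rewrite -EFinM lee_fin /g ComplexField.Normc.normcM.
rewrite [(normc c * _) ^+ 2]exprMn.
rewrite [leLHS]mulrCA -[leRHS]mulrA; apply: ler_wpM2l; first exact: sqr_ge0.
rewrite [leRHS]mulrA; apply: ler_wpM2r; first exact: sqr_ge0.
have -> : l `^ s ^+ 2 = (l ^+ 2) `^ s.
  by rewrite expr2 -powRM ?(ltW l0)// -expr2.
have ge0 (y : R) : 0 <= 1 + y ^+ 2 by rewrite addr_ge0// sqr_ge0.
rewrite -powRM ?sqr_ge0 ?ge0//.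
apply: ge0_ler_powR; rewrite ?nnegrE ?ge0 ?mulr_ge0 ?(ltW l0) ?ge0//.
rewrite mulrDr mulr1 exprMn lerD2r expr2.
by rewrite mulr_ege1.
Qed.

End NullSobolev.

(** * The lower bound *)

Lemma is_sobolev_norm_le (R : realType) (s B : R) (f F : R -> R[i]) :
  0 <= B -> is_fourier f F ->
  (\int[@lebesgue_measure R]_x ((1 + x ^+ 2) `^ s * normc (F x) ^+ 2)%R%:E
     <= (B ^+ 2)%:E)%E ->
  exists2 N, is_sobolev_norm s f N & N <= B.
Proof.
move=> B0 fF IB.
set I := integral _ _ _ in IB.
have I0 : (0 <= I)%E.
  by apply: integral_ge0 => x _; rewrite lee_fin mulr_ge0 ?powR_ge0 ?sqr_ge0.
have If : I \is a fin_num by rewrite ge0_fin_numE// (le_lt_trans IB)// ltry.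
exists (Num.sqrt (fine I)).
  exists F => //; rewrite -/I -(fineK If) poweR_EFin powR12_sqrt//.
  exact: fine_ge0.
rewrite -(ger0_norm B0) -sqrtr_sqr ler_wsqrtr//.
by rewrite -lee_fin fineK.
Qed.

Lemma rescaled_sobolev_le (R : realType) (s kappa E delta l M : R) k :
  0 < s -> 0 < E -> 0 < delta -> 1 <= l -> l `^ s = E / delta ->
  0 <= kappa -> 0 <= M -> kappa * M <= 1 ->
  (\int[@lebesgue_measure R]_x
     ((1 + x ^+ 2) `^ s * normc (gamma_hat k x) ^+ 2)%R%:E <= (M ^+ 2)%:E)%E ->
  (\int[@lebesgue_measure R]_x ((1 + x ^+ 2) `^ s *
     normc ((kappa * delta * Num.sqrt l)%:C * l^-1%:C *
       gamma_hat k (l^-1 * x)) ^+ 2)%R%:E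
     <= (E ^+ 2)%:E)%E.
Proof.
move=> s0 E0 d0 l1 lE k0 M0 kM IM.
have l0 : 0 < l := lt_le_trans ltr01 l1.
apply: (le_trans (sobolev_integral_dilation _ (ltW s0) l1
  (cmeasurable_gamma_hat k))).
apply: (@le_trans _ _ ((kappa * E) ^+ 2 * M ^+ 2)%:E); last first.
  rewrite lee_fin -exprMn ler_pXn2r ?nnegrE ?mulr_ge0 ?(ltW E0)//.
  by rewrite mulrAC -[leRHS]mul1r ler_wpM2r ?(ltW E0).
rewrite [leRHS]EFinM; apply: lee_pmul => //.
- by rewrite lee_fin (mulr_ge0 (mulr_ge0 (sqr_ge0 _) (ltW l0)) (sqr_ge0 _)).
- by apply: integral_ge0 => x _; rewrite lee_fin mulr_ge0 ?powR_ge0 ?sqr_ge0.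
rewrite lee_fin lE ComplexField.Normc.normcM !normc_real.
rewrite !ger0_norm ?invr_ge0 ?mulr_ge0 ?sqrtr_ge0 ?(ltW l0) ?(ltW d0)//.
rewrite !exprMn sqr_sqrtr ?(ltW l0)//.
have ln0 : l != 0 by rewrite gt_eqF.
have dn0 : delta != 0 by rewrite gt_eqF.
rewrite le_eqVlt; apply/predU1P; left; field.
by rewrite ln0 dn0.
Qed.

Theorem theorem2 (R : realType) (s : R) (p : nat) (hs : 0 < s)
    (hps : p%:R < s) :
  exists2 c0 : R, 0 < c0 &
    forall A : (R -> R[i]) -> (R -> R[i]), L2_linear_operator A ->
    forall E delta : R, 0 < E -> 0 < delta -> delta <= E ->
    exists f fp fdelta : R -> R[i],
      [/\ exists2 N : R, is_sobolev_norm s f N & N <= E,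
          in_L2 fdelta,
          (L2norm (f \- fdelta)%R < delta%:E)%E,
          is_weak_derivative p f fp &
          ((c0 * (E `^ (p%:R / s) * delta `^ (1 - p%:R / s)))%:E
             <= L2norm (fp \- A fdelta)%R)%E].
Proof.
have [m sm] : exists m : nat, s <= m%:R.
  by exists (Num.bound s); apply/ltW/archi_boundP/ltW.
have pm : (p <= m)%N by rewrite -(ler_nat R) (le_trans (ltW hps)).
have phi2 := @gamma_wave_in_L2 R m; have phi1 := @gamma_wave_in_L1 R m.
have psi2 := @gamma_deriv_in_L2 R p m; have psi1 := @gamma_deriv_in_L1 R p m.
have [N0f N1f] := (L2norm_fin phi2, L2norm_fin psi2).
pose N0 := fine (L2norm (@gamma_wave R m)).
pose N1 := fine (L2norm (@gamma_deriv R p m)).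
have L2norm_ge0 (g : R -> R[i]) : (0 <= L2norm g)%E.
  by rewrite L2normE poweR_ge0.
have N0ge0 : 0 <= N0 by exact: fine_ge0.
have N1gt0 : 0 < N1.
  rewrite fine_gt0// lt0e L2norm_gamma_deriv_neq0//= L2norm_ge0.
  by rewrite -ge0_fin_numE.
pose I := (\int[@lebesgue_measure R]_x
     ((1 + x ^+ 2) `^ s * normc (gamma_hat m x) ^+ 2)%R%:E)%E.
have Ilt : (I < +oo)%E.
  apply: integral_sqr_gamma_hat_lty => [|x|x].
  - apply: (measurableT_comp (measurable_powR s)).
    by apply: measurable_funD => //; apply: measurable_funX.
  - exact: powR_ge0.
  - rewrite -[leRHS]powR_mulrn ?addr_ge0 ?sqr_ge0// ler_powR//.
    by rewrite lerDl sqr_ge0.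
have I0 : (0 <= I)%E.
  by apply: integral_ge0 => x _; rewrite lee_fin mulr_ge0 ?powR_ge0 ?sqr_ge0.
have If : I \is a fin_num by rewrite ge0_fin_numE.
pose M := Num.sqrt (fine I).
have IM : (I <= (M ^+ 2)%:E)%E by rewrite sqr_sqrtr ?fine_ge0// fineK.
have M0 : 0 <= M := sqrtr_ge0 _.
(* The summand 1 makes [kappa * N0] strictly less than 1: the distance between
   [f] and its datum must be strictly below [delta]. *)
pose kappa := (1 + N0 + M)^-1.
have D0 : 0 < 1 + N0 + M by rewrite -addrA ltr_pwDl// addr_ge0.
have k0 : 0 < kappa by rewrite invr_gt0.
have kM : kappa * M <= 1 by rewrite mulrC ler_pdivrMr// mul1r lerDr addr_ge0.
have kN : kappa * N0 < 1 by rewrite mulrC ltr_pdivrMr// mul1r; lra.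
exists (kappa * N1) => [|A LA E delta E0 d0 dE]; first by rewrite mulr_gt0.
(* The scale at which the L^2 and the H^s constraint on [f] bind together. *)
pose l := (E / delta) `^ s^-1.
have q1 : 1 <= E / delta by rewrite ler_pdivlMr// mul1r.
have q0 : 0 < E / delta by rewrite divr_gt0.
have l1 : 1 <= l by rewrite -(powRr0 (E / delta)) ler_powR// invr_ge0 ltW.
have l0 : 0 < l := lt_le_trans ltr01 l1.
have lE : l `^ s = E / delta by rewrite -powRrM mulVf ?gt_eqF// powRr1// ltW.
have sl0 : Num.sqrt l != 0 by rewrite gt_eqF// sqrtr_gt0.
(* [sqrt l] compensates the effect of the dilation on the L^2 norm. *)
pose a := kappa * delta * Num.sqrt l.
have a0 : 0 < a by rewrite !mulr_gt0// sqrtr_gt0.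
pose f x : R[i] := a%:C * gamma_wave m (l * x).
pose fp x : R[i] := (a * l ^+ p)%:C * gamma_deriv p m (l * x).
have Ff : fourier_integral f =
    fun xi => a%:C * l^-1%:C * gamma_hat m (l^-1 * xi).
  by apply/funext => xi; rewrite fourier_integral_dilation// fourier_gamma_wave.
have Ffp : fourier_integral fp =
    fun xi => (0 +i* xi) ^+ p * fourier_integral f xi.
  apply/funext => xi.
  rewrite fourier_integral_dilation// fourier_gamma_deriv// Ff.
  have -> : 0 +i* xi = l%:C * (0 +i* (l^-1 * xi)).
    apply/eqP; rewrite eq_complex Re_mul Im_mul /=.
    by rewrite !mul0r mulr0 subr0 addr0 mulVKf ?lt0r_neq0// !eqxx.
  by rewrite exprMn !rmorphM rmorphXn /=; ring.
have f1 : in_L1 f by exact: in_L1_dilation.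
have f2 : in_L2 f by exact: in_L2_dilation.
have fp1 : in_L1 fp by exact: in_L1_dilation.
have fp2 : in_L2 fp by exact: in_L2_dilation.
have hat0 : in_L2 (@gamma_hat R m).
  have := @gamma_deriv_hat_in_L2 R 0 m (leq0n m).
  by under eq_fun do rewrite expr0 mul1r.
have isF : is_fourier f (fourier_integral f).
  apply: is_fourier_integral => //; rewrite Ff.
  by apply: in_L2_dilation => //; rewrite invr_gt0.
have isFp : is_fourier fp (fourier_integral fp).
  apply: is_fourier_integral => //.
  have -> : fourier_integral fp = (fun xi => (a * l ^+ p)%:C * l^-1%:C *
      ((0 +i* (l^-1 * xi)) ^+ p * gamma_hat m (l^-1 * xi))).
    apply/funext => xi.
    by rewrite fourier_integral_dilation// fourier_gamma_deriv.
  by apply: (in_L2_dilation _ _ (gamma_deriv_hat_in_L2 pm)); rewrite invr_gt0.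
have L2f : L2norm f = (kappa * delta * N0)%:E.
  rewrite L2norm_dilation//; last exact: in_L2_cmeasurable.
  rewrite normc_real (gtr0_norm a0) -(fineK N0f) -EFinM; congr _%:E.
  by rewrite /a mulfK.
have L2fp : L2norm fp = (kappa * delta * l ^+ p * N1)%:E.
  rewrite L2norm_dilation//; last exact: in_L2_cmeasurable.
  have al0 : 0 < a * l ^+ p by rewrite mulr_gt0// exprn_gt0.
  rewrite normc_real (gtr0_norm al0) -(fineK N1f) -EFinM.
  by rewrite /a [_ * l ^+ p]mulrAC mulfK.
exists f, fp, (fun=> 0); split.
- apply: (is_sobolev_norm_le (ltW E0) isF); rewrite Ff.
  exact: (rescaled_sobolev_le hs E0 d0 l1 lE (ltW k0) M0 kM IM).
- exact: in_L2_zero.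
- have -> : (f \- (fun=> 0)) = f by apply/funext => x /=; rewrite subr0.
  by rewrite L2f lte_fin mulrAC gtr_pMl.
- by exists (fourier_integral f) => //; rewrite -Ffp.
- have -> : L2norm (fp \- A (fun=> 0)) = L2norm fp.
    apply: L2norm_ae.
    + apply/in_L2_cmeasurable/in_L2B => //.
      exact: (L2op_in_L2 LA (@in_L2_zero R)).
    + exact: in_L2_cmeasurable.
    + have := L2op_zero LA; rewrite /ae_equal.
      apply: (@filterS _ _ (ae_filter_ringOfSetsType (@lebesgue_measure R))).
      by move=> x /= ->; rewrite subr0.
  rewrite L2fp lee_fin le_eqVlt; apply/predU1P; left.
  have lp : l ^+ p = (E / delta) `^ (p%:R / s).
    by rewrite -powR_mulrn ?(ltW l0)// /l -powRrM [s^-1 * _]mulrC.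
  have dn0 : delta != 0 by rewrite gt_eqF.
  have -> : delta `^ (1 - p%:R / s) = delta / delta `^ (p%:R / s).
    by rewrite powRB ?dn0 ?implybT// powRr1// ltW.
  have dV : delta^-1 `^ (p%:R / s) = (delta `^ (p%:R / s))^-1.
    by rewrite -powR_inv1 ?(ltW d0)// -powRrM mulN1r powRN.
  rewrite lp powRM ?invr_ge0 ?(ltW E0) ?(ltW d0)// dV.
  by ring.
Qed.
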